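(* Let $M$ be a smooth manifold, $\tau\in\Omega^1(M)$ nowhere-vanishing, $\omega\in\Omega^2(M)$, and suppose that $(\tau,\omega)$ is a doublet of class $\ge 3$. Then the kernel of the extended 3-form $\tau\wedge\omega$ is the extended characteristic distribution: $$\operatorname{Ker}(\tau\wedge\omega)=\mathcal X_{(\tau,\omega)}.$$
   Context: For a $p$-form $\alpha$, $\operatorname{Ker}\alpha_x=\{v\in T_xM\mid\iota_v\alpha_x=0\}$. The class of $(\tau,\omega)$ at $x$ is the codimension in $T_xM$ of $\operatorname{Ker}\tau_x\cap\operatorname{Ker}\omega_x$; a doublet is a pair with constant class. The extended characteristic distribution of $(\tau,\omega)$ at $x$ is $\mathcal X_{(\tau,\omega)_x}=\{v\in\operatorname{Ker}\tau_x\mid\iota_v\omega_x=a\,\tau_x\text{ for some }a\in\mathbb R\}$. *)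

(* Defs.v *)
From HB Require Import structures.
From mathcomp Require Import all_boot all_order all_fingroup all_algebra.
From mathcomp Require Import all_classical all_reals.
From mathcomp Require Import topology normedtype landau derive.

Set Implicit Arguments.
Unset Strict Implicit.
Unset Printing Implicit Defensive.

Import Order.TTheory GRing.Theory Num.Theory.
Import numFieldNormedType.Exports.

Local Open Scope classical_set_scope.
Local Open Scope ring_scope.

(* * Differential calculus in normed spaces *)

Section Calc.
Context (R : realType) (V : normedModType R).

Lemma near_eq_differentiable_diff (W : normedModType R) (f g : V -> W) x :
  (\forall y \near x, f y = g y) -> differentiable f x ->
  differentiable g x /\ 'd g x = 'd f x :> (V -> W).
Proof.
move=> fg df.
have cf := diff_continuous df.
have gE : g \o shift x = cst (g x) + 'd f x +o_ 0 id.
  have /eqaddoP fE := diff_locally df.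
  apply/eqaddoP => e e0; have fe := fE _ e0.
  have fgs : \forall h \near 0, f (h + x) = g (h + x).
    by move: fg; rewrite (near_shift 0) subr0.
  have fgx : f x = g x by exact: nbhs_singleton fg.
  near=> h.
  have := near fe h; rewrite /= /GRing.add /GRing.opp /= /cst.
  rewrite -fgx -(near fgs h) //.
  by apply.
have dE := diff_unique cf gE.
by split=> //; apply/diff_locallyP; rewrite dE.
Unshelve. all: by end_near. Qed.

(* For U open, f is C^(k+1) on U iff it is Frechet-differentiable on U and all
   its directional derivatives are C^k on U. *)
Fixpoint Ck (W : normedModType R) (k : nat) (U : set V) (f : V -> W) : Prop :=
  if k is k'.+1 then
    (forall x, U x -> differentiable f x) /\
    (forall v, Ck k' U (fun x => 'D_v f x))
  else forall x, U x -> {for x, continuous f}.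

Definition smooth_on (W : normedModType R) (U : set V) (f : V -> W) : Prop :=
  forall k, Ck k U f.

Lemma Ck_eq (W : normedModType R) k (U : set V) (f g : V -> W) :
  open U -> {in U, f =1 g} -> Ck k U f -> Ck k U g.
Proof.
move=> oU; elim: k f g => [|k IH] f g fg.
  move=> cf x Ux; have nU := open_nbhs_nbhs (conj oU Ux).
  rewrite /prop_for /continuous_at -(fg x (mem_set Ux)).
  apply: cvg_trans (cf x Ux); apply: near_eq_cvg.
  by near=> y; apply: fg; apply: mem_set; near: y.
have nfg x : U x -> \forall y \near x, f y = g y.
  move=> Ux; have nU := open_nbhs_nbhs (conj oU Ux).
  by near=> y; apply: fg; apply: mem_set; near: y.
case=> df cf; split=> [x Ux|v].
  by have [] := near_eq_differentiable_diff (nfg x Ux) (df _ Ux).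
apply: IH (cf v) => x /set_mem Ux; apply: near_eq_derive; exact: nfg.
Unshelve. all: by end_near. Qed.

Lemma CkS (W : normedModType R) k (U : set V) (f : V -> W) :
  Ck k.+1 U f -> Ck k U f.
Proof.
elim: k f => [|k IH] f [df cf].
  by move=> x Ux; apply: differentiable_continuous; exact: df.
by split=> // v; apply: IH; exact: cf.
Qed.

Lemma Ck_cst (W : normedModType R) k (U : set V) (c : W) : Ck k U (cst c).
Proof.
elim: k c => [|k IH] c; first by move=> x _; exact: cst_continuous.
split=> [x _|v]; first exact: differentiable_cst.
suff -> : (fun x => 'D_v (cst c) x) = cst 0 by exact: IH.
by apply/funext => x; rewrite derive_cst.
Qed.

Lemma CkD (W : normedModType R) k (U : set V) (f g : V -> W) :
  open U -> Ck k U f -> Ck k U g -> Ck k U (f + g).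
Proof.
move=> oU; elim: k f g => [|k IH] f g.
  by move=> cf cg x Ux; apply: continuousD; [exact: cf|exact: cg].
move=> [df cf] [dg cg]; split=> [x Ux|v].
  by apply: differentiableD; [exact: df|exact: dg].
apply: Ck_eq oU _ (IH _ _ (cf v) (cg v)) => x /set_mem Ux.
by rewrite deriveD //; apply: diff_derivable; [exact: df|exact: dg].
Qed.

Lemma CkM k (U : set V) (f g : V -> R) :
  open U -> Ck k U f -> Ck k U g -> Ck k U (f * g).
Proof.
move=> oU; elim: k f g => [|k IH] f g.
  by move=> cf cg x Ux; apply: continuousM; [exact: cf|exact: cg].
move=> Cf Cg; have [df cf] := Cf; have [dg cg] := Cg; split=> [x Ux|v].
  by apply: differentiableM; [exact: df|exact: dg].
apply: Ck_eq oU _ (CkD oU (IH _ _ (CkS Cf) (cg v)) (IH _ _ (CkS Cg) (cf v))).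
move=> x /set_mem Ux.
by rewrite deriveM //; apply: diff_derivable; [exact: df|exact: dg].
Qed.

Lemma smooth_onM (U : set V) (f g : V -> R) :
  open U -> smooth_on U f -> smooth_on U g -> smooth_on U (f * g).
Proof. by move=> oU sf sg k; exact: CkM. Qed.

Lemma smooth_on_sum (I : finType) (U : set V) (F : I -> V -> R) :
  open U -> (forall i, smooth_on U (F i)) -> smooth_on U (\sum_i F i).
Proof.
move=> oU sF k; elim/big_rec: _ => [|i f _ Cf]; first exact: Ck_cst.
by apply: CkD => //; exact: sF.
Qed.
End Calc.

Lemma derive_id_on (R : realType) (V : normedModType R) (A : set V)
    (h : V -> V) (x v : V) :
  open A -> A x -> (forall z, A z -> h z = z) -> 'D_v h x = v.
Proof.
move=> oA Ax hid; rewrite -(near_eq_derive (f := id)) ?derive_id //.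
have : nbhs x A by apply: open_nbhs_nbhs; split.
by apply: filterS => z /hid.
Qed.

Lemma derive_comp_on (R : realType) (U V W : normedModType R)
    (A : set U) (B : set V) (f : U -> V) (g : V -> W) (h : U -> W)
    (x : U) (v : U) :
  open A -> A x -> Ck 1 A f -> B (f x) -> Ck 1 B g ->
  (forall z, A z -> g (f z) = h z) ->
  'D_v h x = 'D_('D_v f x) g (f x).
Proof.
move=> oA Ax [df _] By [dg _] gfh.
rewrite -(near_eq_derive (f := g \o f)); last first.
  have : nbhs x A by apply: open_nbhs_nbhs; split.
  by apply: filterS.
have dfx := df _ Ax; have dgx := dg _ By.
rewrite (deriveE _ (differentiable_comp dfx dgx)) (diff_comp dfx dgx) /=.
by rewrite (deriveE _ dgx) (deriveE _ dfx).
Qed.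

Lemma derive_jacobian (R : realType) m n (A : set 'rV[R]_m)
    (f : 'rV[R]_m -> 'rV[R]_n) (x v : 'rV[R]_m) :
  A x -> Ck 1 A f -> 'D_v f x = v *m 'J f x.
Proof. by move=> Ax [df _]; rewrite deriveEjacobian //; exact: df. Qed.

(* * Alternating forms on a vector space *)

Definition subst_at (T : Type) (p : nat) (w : 'I_p -> T) (i : 'I_p) (u : T) :
  'I_p -> T := fun j => if j == i then u else w j.

Definition alternating_multilinear (R : realType) (V : lmodType R) (p : nat)
    (f : ('I_p -> V) -> R) : Prop :=
  (forall (w : 'I_p -> V) (i : 'I_p) (a : R) (u v : V),
      f (subst_at w i (a *: u + v)) =
      a * f (subst_at w i u) + f (subst_at w i v)) /\
  (forall (w : 'I_p -> V) (i j : 'I_p), i != j -> w i = w j -> f w = 0).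

Definition altform_pred (R : realType) (V : lmodType R) (p : nat) :
  {pred ('I_p -> V) -> R^o} := [pred f | `[< alternating_multilinear f >]].

Lemma altform_submod_closed (R : realType) (V : lmodType R) (p : nat) :
  submod_closed (@altform_pred R V p).
Proof.
split=> [|a f g].
  by rewrite inE; split=> *; rewrite /GRing.zero/= ?mulr0 ?addr0.
rewrite !inE => -[fl fa] [gl ga]; split.
  move=> w i b u v /=.
  rewrite /GRing.add /GRing.scale /= /GRing.scale /= fl gl.
  by rewrite !mulrDr !mulrA (mulrC a b) addrACA.
move=> w i j ij wij.
rewrite /GRing.add /GRing.scale /= /GRing.scale /=.
by rewrite (fa _ _ _ ij wij) (ga _ _ _ ij wij) mulr0 addr0.
Qed.

HB.instance Definition _ (R : realType) (V : lmodType R) (p : nat) :=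
  GRing.isSubmodClosed.Build R (('I_p -> V) -> R^o) (@altform_pred R V p)
    (@altform_submod_closed R V p).

Record altform (R : realType) (V : lmodType R) (p : nat) := Altform {
  altform_fun :> ('I_p -> V) -> R^o ;
  altform_funP : altform_fun \in @altform_pred R V p }.

HB.instance Definition _ (R : realType) (V : lmodType R) (p : nat) :=
  [isSub of altform V p for @altform_fun R V p].
HB.instance Definition _ (R : realType) (V : lmodType R) (p : nat) :=
  [Choice of altform V p by <:].
HB.instance Definition _ (R : realType) (V : lmodType R) (p : nat) :=
  [SubChoice_isSubLmodule of altform V p by <:].

Section AltTheory.
Context (R : realType) (V : lmodType R).

Lemma altformP p (f : altform V p) : alternating_multilinear f.
Proof. by have := altform_funP f; rewrite inE. Qed.

Lemma mk_altform_proof p (f : ('I_p -> V) -> R) :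
  alternating_multilinear f -> (f : _ -> R^o) \in @altform_pred R V p.
Proof. by rewrite inE. Qed.

Lemma altform_inj p (f g : altform V p) : (forall w, f w = g w) -> f = g.
Proof. by move=> fg; apply/val_inj/funext. Qed.

Definition fcons (p : nat) (v : V) (w : 'I_p -> V) : 'I_p.+1 -> V :=
  fun j => if unlift ord0 j is Some k then w k else v.

Lemma fcons_subst_at p v (w : 'I_p -> V) i u :
  fcons v (subst_at w i u) = subst_at (fcons v w) (lift ord0 i) u.
Proof.
apply/funext => j; rewrite /fcons /subst_at.
case: unliftP => [k ->|->]; first by rewrite (inj_eq (@lift_inj _ ord0)).
by rewrite (negbTE (neq_lift ord0 i)).
Qed.

Lemma iprod_subproof p (f : altform V p.+1) (v : V) :
  alternating_multilinear (fun w : 'I_p -> V => f (fcons v w)).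
Proof.
have [fl fa] := altformP f; split=> [w i a u u'|w i j ij wij].
  by rewrite !fcons_subst_at fl.
apply: (fa _ (lift ord0 i) (lift ord0 j)).
  by rewrite (inj_eq (@lift_inj _ ord0)).
by rewrite /fcons !liftK.
Qed.

Definition iprod p (v : V) (f : altform V p.+1) : altform V p :=
  Altform (mk_altform_proof (iprod_subproof f v)).

Lemma iprod_linear p (f : altform V p.+1) a u v :
  iprod (a *: u + v) f = a *: iprod u f + iprod v f.
Proof.
have fconsE x w : fcons x w = subst_at (fcons 0 w) ord0 x.
  apply/funext => j; rewrite /fcons /subst_at.
  by case: unliftP => [k ->|-> //]; rewrite eq_sym (negbTE (neq_lift _ _)).
apply: altform_inj => w; have [fl _] := altformP f.
by rewrite /= fconsE fl -!fconsE.
Qed.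

Lemma iprod0 p (f : altform V p.+1) : iprod 0 f = 0.
Proof.
by have := iprod_linear f (-1) 0 0; rewrite scaler0 addr0 scaleN1r addNr.
Qed.

(* The normalisation 1 / (p! q!) is the one for which, for 1-forms a and b,
   (a /\ b)(u, v) = a(u) b(v) - a(v) b(u). *)
Definition wedge_fun p q (f : altform V p) (g : altform V q)
    (w : 'I_(p + q) -> V) : R :=
  (p`!%:R * q`!%:R)^-1 *
  \sum_(s : 'S_(p + q)) (-1) ^+ s *
    (f (fun i => w (s (lshift q i))) * g (fun j => w (s (rshift p j)))).

Lemma subst_at_perm n m (w : 'I_n -> V) (h : 'I_m -> 'I_n) i k u :
  injective h -> h k = i ->
  (fun j => subst_at w i u (h j)) = subst_at (fun j => w (h j)) k u.
Proof.
by move=> hi hk; apply/funext => j; rewrite /subst_at -hk (inj_eq hi).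
Qed.

Lemma subst_at_out n m (w : 'I_n -> V) (h : 'I_m -> 'I_n) i u :
  (forall j, h j != i) -> (fun j => subst_at w i u (h j)) = (fun j => w (h j)).
Proof. by move=> hk; apply/funext => j; rewrite /subst_at (negbTE (hk j)). Qed.

Lemma wedge_subproof p q (f : altform V p) (g : altform V q) :
  alternating_multilinear (wedge_fun f g).
Proof.
have [fl fa] := altformP f; have [gl ga] := altformP g.
split=> [w i a u v|w i j ij wij].
  rewrite /wedge_fun mulrCA -mulrDr; congr (_ * _).
  rewrite mulr_sumr -big_split; apply: eq_bigr => s _ /=.
  have linj : injective (fun k : 'I_p => s (lshift q k)).
    by move=> x y /perm_inj /lshift_inj.
  have rinj : injective (fun k : 'I_q => s (rshift p k)).
    by move=> x y /perm_inj /rshift_inj.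
  case: (split_ordP (s^-1 i)%g) => k hk.
    have sk : s (lshift q k) = i by rewrite -hk permKV.
    have so j : s (rshift p j) != i.
      by rewrite -sk (inj_eq perm_inj) eq_rlshift.
    rewrite !(subst_at_perm _ _ linj sk) !(subst_at_out _ _ so) fl.
    by rewrite mulrDl mulrDr -mulrA; congr (_ + _); exact: mulrCA.
  have sk : s (rshift p k) = i by rewrite -hk permKV.
  have so j : s (lshift q j) != i.
    by rewrite -sk (inj_eq perm_inj) eq_lrshift.
  rewrite !(subst_at_perm _ _ rinj sk) !(subst_at_out _ _ so) gl.
  rewrite 2!mulrDr; congr (_ + _); rewrite [RHS]mulrCA; congr (_ * _).
  exact: mulrCA.
rewrite /wedge_fun; set S := (X in _ * X).
suff /eqP : S = - S.
  by rewrite -addr_eq0 -mulr2n mulrn_eq0 /= => /eqP->; rewrite mulr0.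
rewrite {1}/S (reindex_inj (mulIg (tperm i j))) /= -sumrN.
apply: eq_bigr => s _; rewrite odd_permM odd_tperm ij /= addbT signrN mulNr.
have wt k : w (tperm i j k) = w k.
  by case: tpermP => [->|->|].
by congr (- (_ * (_ * _))); congr (_ _); apply/funext => k; rewrite permM wt.
Qed.

Definition wedge p q (f : altform V p) (g : altform V q) : altform V (p + q) :=
  Altform (mk_altform_proof (wedge_subproof f g)).

Definition Ker p (f : altform V p.+1) : set V := [set v | iprod v f = 0].

Definition extended_char (t : altform V 1) (o : altform V 2) : set V :=
  [set v | Ker t v /\ exists a : R, iprod v o = a *: t].

End AltTheory.

Section Codim.
Context (R : realType) (V : vectType R).

(* The default value 0%VS is only reached when A is not a subspace:
   see vspace_ofE. *)
Definition vspace_of (A : set V) : {vspace V} :=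
  xget 0%VS [set U : {vspace V} | [set` U] = A].

Definition codim (A : set V) : nat := \dim {:V} - \dim (vspace_of A).

Lemma vspace_ofE (A : set V) :
  A 0 -> (forall a u v, A u -> A v -> A (a *: u + v)) ->
  [set` vspace_of A] = A.
Proof.
move=> A0 AD.
have AZ a v : A v -> A (a *: v) by move=> Av; rewrite -[_ *: _]addr0; exact: AD.
pose P d := `[< exists U : {vspace V}, \dim U = d /\ [set` U] `<=` A >].
have P0 : exists d, P d.
  exists 0%N; apply/asboolP; exists 0%VS; split; first exact: dimv0.
  by move=> v; rewrite /= memv0 => /eqP->.
have Pub d : P d -> (d <= \dim {:V})%N.
  by move=> /asboolP[U [<- _]]; rewrite dimvS // subvf.
case: (ex_maxnP P0 Pub) => d /asboolP[U [dU UA]] dmax.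
rewrite /vspace_of; case: xgetP => [W -> //|/(_ U) []].
apply/seteqP; split=> // v Av; apply: contrapT => /negP vU.
have : P (\dim (U + <[v]>)%VS).
  apply/asboolP; exists (U + <[v]>)%VS; split=> //.
  move=> w /= /memv_addP[u uU [_ /vlineP[a ->] ->]].
  by rewrite addrC; apply: AD => //; exact: UA.
move=> /dmax; rewrite -dU leqNgt => /negP; apply.
rewrite ltn_neqAle dimvS ?addvSl // andbT.
apply: contra vU => dE; have : (U == U + <[v]>)%VS.
  by rewrite eqEdim addvSl /= (eqP dE).
by move=> /eqP->; rewrite memvE addvSr.
Qed.

Lemma vspace_of_KerI p q (f : altform V p.+1) (g : altform V q.+1) :
  [set` vspace_of (Ker f `&` Ker g)] = Ker f `&` Ker g.
Proof.
apply: vspace_ofE => [|a u v [uf ug] [vf vg]].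
  by split; exact: iprod0.
by split; rewrite /Ker /= iprod_linear ?(uf, ug, vf, vg) scaler0 addr0.
Qed.
End Codim.

(* * Smooth manifolds, tangent spaces and differential forms *)

(* A homeomorphism from chart_dom onto chart_cod, with inverse chart_inv; the
   values of chart_to and chart_inv outside these open sets are irrelevant. *)
Record chart (R : realType) (n : nat) (M : topologicalType) := Chart {
  chart_dom : set M ;
  chart_cod : set 'rV[R]_n ;
  chart_to : M -> 'rV[R]_n ;
  chart_inv : 'rV[R]_n -> M ;
  chart_dom_open : open chart_dom ;
  chart_cod_open : open chart_cod ;
  chart_to_cod : forall x, chart_dom x -> chart_cod (chart_to x) ;
  chart_inv_dom : forall y, chart_cod y -> chart_dom (chart_inv y) ;
  chart_toK : forall x, chart_dom x -> chart_inv (chart_to x) = x ;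
  chart_invK : forall y, chart_cod y -> chart_to (chart_inv y) = y ;
  chart_to_continuous :
    forall x, chart_dom x -> {for x, continuous chart_to} ;
  chart_inv_continuous :
    forall y, chart_cod y -> {for y, continuous chart_inv} }.

Definition transition (R : realType) (n : nat) (M : topologicalType)
  (c d : chart R n M) : 'rV[R]_n -> 'rV[R]_n := chart_to d \o chart_inv c.

Definition transition_dom (R : realType) (n : nat) (M : topologicalType)
  (c d : chart R n M) : set 'rV[R]_n :=
  chart_cod c `&` chart_inv c @^-1` chart_dom d.

(* The atlas is an arbitrary smooth atlas, not necessarily the maximal one of
   the smooth structure. The carrier may be empty and n may be 0. *)
Record manifold (R : realType) (n : nat) := Manifold {
  carrier :> topologicalType ;
  manifold_hausdorff : hausdorff_space carrier ;
  manifold_second_countable : @second_countable carrier ;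
  atlas : Type ;
  chart_of : atlas -> chart R n carrier ;
  atlas_cover : forall x, exists i, chart_dom (chart_of i) x ;
  atlas_smooth : forall i j,
    smooth_on (transition_dom (chart_of i) (chart_of j))
              (transition (chart_of i) (chart_of j)) }.

Section Tangent.
Context (R : realType) (n : nat) (M : manifold R n).

Notation dom i := (chart_dom (chart_of (m := M) i)).
Notation phi i := (chart_to (chart_of (m := M) i)).
Notation psi i := (chart_inv (chart_of (m := M) i)).
Notation trans i j := (transition (chart_of (m := M) i) (chart_of j)).
Notation tdom i j := (transition_dom (chart_of (m := M) i) (chart_of j)).

(* A tangent vector at x is the family (t i) of its coordinates in the charts
   around x, subject to the change of coordinates rule; 'J acts on row vectors
   on the right. Charts that do not contain x carry the junk value 0, which
   avoids indexing the family by a dependent type. *)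
Definition tangent_pred (x : M) : {pred atlas M -> 'rV[R]_n} :=
  [pred t | `[< (forall i, ~ dom i x -> t i = 0) /\
     (forall i j, dom i x -> dom j x ->
        t j = t i *m 'J (trans i j) (phi i x)) >]].

Lemma tangent_submod_closed (x : M) : submod_closed (tangent_pred x).
Proof.
split=> [|a t u]; first by rewrite inE; split=> // i j _ _; rewrite mul0mx.
rewrite !inE => -[t0 tE] [u0 uE]; split.
  move=> i xi; rewrite /GRing.add /GRing.scale /= t0 // u0 //.
  by rewrite scaler0 addr0.
move=> i j xi xj; rewrite {1}/GRing.add /= {1}/GRing.scale /=.
by rewrite (tE i j) // (uE i j) // mulmxDl scalemxAl.
Qed.

HB.instance Definition _ (x : M) :=
  GRing.isSubmodClosed.Build R (atlas M -> 'rV[R]_n) (tangent_pred x)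
    (tangent_submod_closed x).

Record tangent (x : M) := Tangent {
  tcoord :> atlas M -> 'rV[R]_n ;
  tcoordP : tcoord \in tangent_pred x }.

HB.instance Definition _ (x : M) := [isSub of tangent x for @tcoord x].
HB.instance Definition _ (x : M) := [Choice of tangent x by <:].
HB.instance Definition _ (x : M) :=
  [SubChoice_isSubLmodule of tangent x by <:].

Lemma transition_dom_open i j : open (tdom i j).
Proof.
rewrite openE => y [yi yj]; rewrite /interior.
have ni : \forall z \near y, chart_cod (chart_of i) z.
  by apply: open_nbhs_nbhs; split=> //; exact: chart_cod_open.
have nj : \forall z \near y, dom j (psi i z).
  apply: (chart_inv_continuous yi).
  by apply: open_nbhs_nbhs; split=> //; exact: chart_dom_open.
by apply: filterS2 ni nj => z.
Qed.

Lemma transition_dom_chart x i j : dom i x -> dom j x -> tdom i j (phi i x).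
Proof.
by move=> xi xj; split; [exact: chart_to_cod | rewrite /= chart_toK].
Qed.

Lemma transition_Ck1 i j : Ck 1 (tdom i j) (trans i j).
Proof. exact: atlas_smooth. Qed.

Lemma jacobian_transition_id x i (v : 'rV[R]_n) :
  dom i x -> v *m 'J (trans i i) (phi i x) = v.
Proof.
move=> xi; have xii := transition_dom_chart xi xi.
rewrite -(derive_jacobian v xii (transition_Ck1 i i)).
apply: derive_id_on (@transition_dom_open i i) xii _.
by move=> y [yi _]; rewrite /transition /= chart_invK.
Qed.

Lemma jacobian_transition_comp x i j k (v : 'rV[R]_n) :
  dom i x -> dom j x -> dom k x ->
  v *m 'J (trans i j) (phi i x) *m 'J (trans j k) (phi j x) =
  v *m 'J (trans i k) (phi i x).
Proof.
move=> xi xj xk; have xij := transition_dom_chart xi xj.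
have xjk := transition_dom_chart xj xk; have xik := transition_dom_chart xi xk.
have xjE : trans i j (phi i x) = phi j x by rewrite /transition /= chart_toK.
apply: etrans (derive_jacobian v xik (transition_Ck1 i k)).
apply: (etrans (esym (derive_jacobian _ xjk (transition_Ck1 j k)))).
have <- := derive_jacobian v xij (transition_Ck1 i j).
rewrite -xjE; apply/esym.
apply: derive_comp_on (@transition_dom_open i j) xij (transition_Ck1 i j) _
  (transition_Ck1 j k) _; first by rewrite xjE.
by move=> y [yi yj]; rewrite /transition /= chart_toK.
Qed.

(* The tangent vector at x with coordinates v in the chart i. *)
Definition tvec_fun (x : M) (i : atlas M) (v : 'rV[R]_n) : atlas M -> 'rV[R]_n :=
  fun j => if `[< dom i x /\ dom j x >] then v *m 'J (trans i j) (phi i x) else 0.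

Lemma tvec_funE x i v j : dom i x -> dom j x ->
  tvec_fun x i v j = v *m 'J (trans i j) (phi i x).
Proof. by move=> xi xj; rewrite /tvec_fun asboolT. Qed.

Lemma tvec_fun0 x i v j : ~ (dom i x /\ dom j x) -> tvec_fun x i v j = 0.
Proof. by move=> xij; rewrite /tvec_fun asboolF. Qed.

Lemma tvec_subproof x i v : tvec_fun x i v \in tangent_pred x.
Proof.
rewrite inE; split=> [j xj|j k xj xk]; first by rewrite tvec_fun0 // => -[].
have [xi|xi] := pselect (dom i x).
  rewrite (tvec_funE v xi xj) (tvec_funE v xi xk).
  exact/esym/jacobian_transition_comp.
rewrite (@tvec_fun0 x i v j) ?(@tvec_fun0 x i v k) ?mul0mx //.
- by case.
- by case.
Qed.

Definition tvec (x : M) (i : atlas M) (v : 'rV[R]_n) : tangent x :=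
  Tangent (tvec_subproof x i v).

Fact tangent_vect_axiom (x : M) : Vector.axiom n (tangent x).
Proof.
have [i xi] := cid (atlas_cover x).
exists (fun t => tcoord t i); first by [].
exists (tvec x i) => [t|v].
  apply/val_inj/funext => j; have := tcoordP t; rewrite inE => -[t0 tE] /=.
  have [xj|xj] := pselect (dom j x).
    by rewrite (tvec_funE _ xi xj) (tE i j).
  by rewrite (t0 j) // tvec_fun0 // => -[].
by rewrite /= (tvec_funE v xi xi) jacobian_transition_id.
Qed.

HB.instance Definition _ (x : M) :=
  Lmodule_hasFinDim.Build R (tangent x) (tangent_vect_axiom x).

Definition coord_vec (x : M) (i : atlas M) (k : 'I_n) : tangent x :=
  tvec x i (delta_mx 0 k).

(* Smoothness of the components of f on the coordinate vector fields of each
   chart of the atlas. *)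
Definition smooth_form (p : nat) (f : forall x : M, altform (tangent x) p) :
    Prop :=
  forall (i : atlas M) (s : 'I_p -> 'I_n),
    smooth_on (chart_cod (chart_of i))
      (fun y => f (psi i y) (fun k => coord_vec (psi i y) i (s k)) : R^o).

Record dform (p : nat) := DForm {
  form_at :> forall x : M, altform (tangent x) p ;
  form_smooth : smooth_form form_at }.

Lemma dwedge_subproof p q (f : dform p) (g : dform q) :
  smooth_form (fun x => wedge (f x) (g x)).
Proof.
move=> i s; set X := fun y k => coord_vec (psi i y) i (s k).
pose c : 'rV[R]_n -> R := cst (p`!%:R * q`!%:R)^-1.
pose F (t : 'S_(p + q)) : 'rV[R]_n -> R := fun y =>
  f (psi i y) (fun k => X y (t (lshift q k))).
pose G (t : 'S_(p + q)) : 'rV[R]_n -> R := fun y =>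
  g (psi i y) (fun k => X y (t (rshift p k))).
pose e (t : 'S_(p + q)) : 'rV[R]_n -> R := cst ((-1) ^+ t).
suff -> : (fun y => wedge (f (psi i y)) (g (psi i y)) (X y)) =
          c * \sum_t e t * (F t * G t).
  have oU := @chart_cod_open _ _ _ (chart_of i).
  apply: smooth_onM => //; first by move=> k; exact: Ck_cst.
  apply: smooth_on_sum => // t; apply: smooth_onM => //.
    by move=> k; exact: Ck_cst.
  apply: smooth_onM => //.
    exact: (form_smooth f i (fun k => s (t (lshift q k)))).
  exact: (form_smooth g i (fun k => s (t (rshift p k)))).
by rewrite fct_sumE; apply/funext.
Qed.

Definition dwedge p q (f : dform p) (g : dform q) : dform (p + q) :=
  DForm (dwedge_subproof f g).

Definition form_class (t : dform 1) (o : dform 2) (x : M) : nat :=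
  codim (Ker (t x) `&` Ker (o x)).

Definition doublet (t : dform 1) (o : dform 2) : Prop :=
  exists c : nat, forall x : M, form_class t o x = c.

End Tangent.

(* Main.v *)
Require Import Defs.
From HB Require Import structures.
From mathcomp Require Import all_boot all_order all_fingroup all_algebra.
From mathcomp Require Import all_classical all_reals topology normedtype.

Set Implicit Arguments.
Unset Strict Implicit.
Unset Printing Implicit Defensive.

Import GRing.Theory Num.Theory.

Local Open Scope classical_set_scope.
Local Open Scope ring_scope.

(** The statement is pointwise, and a fact of linear algebra in each tangent
    space [V], with [t : altform V 1] nonzero and [o : altform V 2].
    Contraction being an antiderivation ([iprod_wedge1]),
    [i_v (t /\ o) = t(v) o - t /\ i_v o].

    If [t(v) = 0], then [v] lies in the kernel of [t /\ o] exactly when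
    [t /\ i_v o = 0], and since [t <> 0] this says that [i_v o] is a multiple
    of [t] ([wedge11_eq0P]): [v] is then an extended characteristic vector.

    If [v] is in the kernel and [t(v) <> 0], then [o] is the decomposable form
    [t(v)^-1 t /\ i_v o]. Every vector killed by the two 1-forms [t] and
    [i_v o] is then in [Ker t] and [Ker o], so that this intersection has
    codimension at most 2 ([codim_Ker_le2]), against the class being at
    least 3.

    What remains is to get the antiderivation formula from the definition of
    the wedge product as a normalised sum over all permutations. The
    permutations are sorted by the index that they send to the argument of
    [t]; those of one class differ by a permutation of the arguments of the
    other factor, and contribute equally because that factor is alternating.
    This gives an expansion along [t] ([wedge1E]), whose first term is the one
    where the contracted vector goes into [t]. *)

(** * Wedge product with a 1-form *)

Section AlternatingForms.
Context (R : realType) (V : lmodType R).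

(** Polarisation: put [w i + w j] in both places [i] and [j] and expand. *)
Lemma altform_tperm p (f : altform V p) (w : 'I_p -> V) (i j : 'I_p) :
  i != j -> f (fun k => w (tperm i j k)) = - f w.
Proof.
move=> ij; have [fl fa] := altformP f.
pose W a b := subst_at (subst_at w i a) j b.
have WC a b : W a b = subst_at (subst_at w j b) i a.
  apply/funext => k; rewrite /W /subst_at.
  by case: (eqVneq k j) => [->|//]; rewrite eq_sym (negbTE ij).
have WDr a b c : f (W a (b + c)) = f (W a b) + f (W a c).
  by have := fl (subst_at w i a) j 1 b c; rewrite scale1r mul1r.
have WDl a b c : f (W (a + b) c) = f (W a c) + f (W b c).
  by rewrite !WC; have := fl (subst_at w j c) i 1 a b; rewrite scale1r mul1r.
have Wdiag a : f (W a a) = 0.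
  by apply: (fa _ i j ij); rewrite /W /subst_at (negbTE ij) !eqxx.
have wE : W (w i) (w j) = w.
  by apply/funext => k; rewrite /W /subst_at; do 2![case: eqVneq => [->|_] //].
have wtE : W (w j) (w i) = fun k => w (tperm i j k).
  apply/funext => k; rewrite /W /subst_at.
  case: tpermP => [->|->|/eqP/negbTE-> /eqP/negbTE-> //].
    by rewrite (negbTE ij) eqxx.
  by rewrite eqxx.
have := Wdiag (w i + w j); rewrite WDl !WDr !Wdiag add0r addr0 wE wtE => /eqP.
by rewrite addrC addr_eq0 => /eqP.
Qed.

Lemma altform_perm p (f : altform V p) (s : 'S_p) (w : 'I_p -> V) :
  f (fun k => w (s k)) = (-1) ^+ s * f w.
Proof.
have [ts -> /allP dts] := prod_tpermP s.
elim: ts w dts => [|[i j] ts IH] w dts.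
  rewrite big_nil odd_perm1 expr0 mul1r.
  by congr (f _); apply/funext => k; rewrite perm1.
have ij : i != j by apply: (dts (i, j)); rewrite mem_head.
rewrite big_cons odd_permM odd_tperm ij /= signrN mulNr.
rewrite -IH => [|t tts]; last by apply: dts; rewrite in_cons tts orbT.
set s' := (\prod_(t <- ts) _)%g.
rewrite -(altform_tperm _ _ ij).
by congr (f _); apply/funext => k; rewrite permM.
Qed.

(** A permutation of [q + 1] elements amounts to the image of the first one and
    a permutation of the others; injectivity and a count suffice. *)
Lemma lift_perm0_bij q :
  bijective (fun x : 'I_q.+1 * 'S_q => lift_perm ord0 x.1 x.2).
Proof.
apply: inj_card_bij => [[i s] [j t] /= st|]; last first.
  by rewrite card_prod card_ord !card_Sn factS.
have ij : i = j by have /permP/(_ ord0) := st; rewrite !lift_perm_id.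
congr pair => //; apply/permP => k; apply: (@lift_inj _ i).
by have /permP/(_ (lift ord0 k)) := st; rewrite !lift_perm_lift -ij.
Qed.

(** The analogue of the expansion of a determinant along a row: the [q!]
    permutations sending the first index to [i] all contribute the same term,
    and their number cancels the factor [1 / q!] of the wedge product. *)
Lemma wedge1E q (t : altform V 1) (g : altform V q) (w : 'I_q.+1 -> V) :
  wedge t g w =
  \sum_(i < q.+1) (-1) ^+ i * (t (fun=> w i) * g (fun j => w (lift i j))).
Proof.
rewrite /= /wedge_fun (_ : 1`! = 1%N) // mul1r.
have q0 : q`!%:R != 0 :> R by rewrite pnatr_eq0 -lt0n fact_gt0.
apply: (canLR (mulKf q0)); rewrite mulr_sumr.
rewrite (reindex _ (onW_bij _ (lift_perm0_bij q))) /=.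
rewrite -(pair_bigA _ (fun i (s : 'S_q) => (-1) ^+ lift_perm ord0 i s *
  (t (fun k => w (lift_perm ord0 i s (lshift q k))) *
   g (fun k => w (lift_perm ord0 i s (rshift 1 k)))))) /=.
apply: eq_bigr => i _.
transitivity (\sum_(s : 'S_q) (-1) ^+ i *
    (t (fun=> w i) * g (fun j => w (lift i j)))); last first.
  by rewrite sumr_const card_Sn mulr_natl.
apply: eq_bigr => s _.
have -> : (fun k : 'I_1 => w (lift_perm ord0 i s (lshift q k))) = fun=> w i.
  apply/funext => k; rewrite (_ : lshift q k = ord0) ?lift_perm_id //.
  by apply/val_inj; rewrite /= ord1.
have -> : (fun k : 'I_q => w (lift_perm ord0 i s (rshift 1 k))) =
    fun k => w (lift i (s k)).
  apply/funext => k; rewrite (_ : rshift 1 k = lift ord0 k) ?lift_perm_lift //.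
  exact/val_inj.
rewrite odd_lift_perm /= (altform_perm g s (fun k => w (lift i k))).
rewrite signr_addb signr_odd -mulrA (mulrCA (t _)); congr (_ * _).
by rewrite signrMK.
Qed.

Lemma wedge1_0 q (t : altform V 1) : wedge t (0 : altform V q) = 0.
Proof.
apply: altform_inj => w; rewrite wedge1E big1 // => i _.
by rewrite [X in _ * X]mulr0 mulr0.
Qed.

(** In the expansion of [t /\ g] on [(v, w)], the term of index 0 has [v] in [t];
    the others have [v] as the first argument of [g] and make up the expansion
    of [t /\ i_v g], with signs shifted by one. *)
Lemma iprod_wedge1 q (t : altform V 1) (g : altform V q.+1) (v : V) :
  iprod v (wedge t g) = (t (fun=> v) : R) *: g - wedge t (iprod v g).
Proof.
apply: altform_inj => w.
have -> : ((t (fun=> v) : R) *: g - wedge t (iprod v g)) w =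
  t (fun=> v) * g w - wedge t (iprod v g) w by [].
rewrite [LHS](wedge1E t g (fcons v w)) wedge1E big_ord_recl expr0 mul1r.
have fcons_lift0 k : fcons v w (lift ord0 k) = w k by rewrite /fcons liftK.
congr (_ * _ + _).
- by congr (t _); apply/funext => k; rewrite /fcons unlift_none.
- by congr (g _); apply/funext => k; rewrite fcons_lift0.
rewrite -sumrN; apply: eq_bigr => k _; rewrite fcons_lift0 /= -mulNr.
rewrite -[X in _ ^+ X]/(bump 0 k) exprS mulN1r; congr (_ * (_ * g _)).
apply/funext => j; rewrite {2}/fcons; case: (unliftP ord0 j) => [l ->|->].
  rewrite -(fcons_lift0 (lift k l)); congr (fcons v w _).
  (* Skipping entry k of w is skipping entry k + 1 of (v, w). *)
  by apply/val_inj; rewrite /= /bump /= !add1n ltnS addnS.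
rewrite (_ : lift _ _ = ord0) /fcons ?unlift_none //.
exact/val_inj.
Qed.

Lemma altform1_linear (t : altform V 1) (a : R) u v :
  t (fun=> a *: u + v) = a * t (fun=> u) + t (fun=> v).
Proof.
have [tl _] := altformP t; have := tl (fun=> 0) ord0 a u v.
have substE (x : V) : subst_at (fun=> 0) (ord0 : 'I_1) x = fun=> x.
  by apply/funext => k; rewrite /subst_at (ord1 k).
by rewrite !substE.
Qed.

Lemma Ker1E (t : altform V 1) v : Ker t v <-> t (fun=> v) = 0.
Proof.
have fcons1 (w : 'I_0 -> V) : fcons v w = fun=> v.
  by apply/funext => k; rewrite ord1 /fcons unlift_none.
split=> [tv|tv]; last by apply: altform_inj => w; rewrite /= fcons1.
have := congr1 (fun f : altform V 0 => f (fun=> 0)) tv.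
by rewrite /= fcons1.
Qed.

Lemma wedge11E (t b : altform V 1) (w : 'I_2 -> V) :
  wedge t b w = t (fun=> w ord0) * b (fun=> w ord_max) -
                t (fun=> w ord_max) * b (fun=> w ord0).
Proof.
rewrite wedge1E big_ord_recl big_ord1 expr0 mul1r expr1 mulN1r.
have -> : lift ord0 ord0 = ord_max :> 'I_2 by exact/val_inj.
by congr (_ * b _ - _ * b _); apply/funext => k; congr w; apply/val_inj;
  rewrite /= ord1.
Qed.

(** Evaluating [t /\ b = 0] on [(e, u)] with [t(e) <> 0] gives
    [t(e) b(u) = t(u) b(e)], so the factor is [b(e) / t(e)]. *)
Lemma wedge11_eq0P (t b : altform V 1) :
  t <> 0 -> wedge t b = 0 <-> exists a : R, b = a *: t.
Proof.
move=> t0; split=> [tb0|[a ->]]; last first.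
  apply: altform_inj => w; rewrite wedge11E /= /GRing.scale /= mulrCA.
  apply/eqP; rewrite subr_eq0; apply/eqP; rewrite [in RHS]mulrCA.
  by rewrite [X in a * X]mulrC.
have const1 (w : 'I_1 -> V) : w = fun=> w ord0.
  by apply/funext => k; rewrite ord1.
have [e te] : exists e, t (fun=> e) != 0.
  apply: contrapT => nt; apply: t0; apply: altform_inj => w.
  by apply: contrapT => /eqP tw; apply: nt; exists (w ord0); rewrite -const1.
exists ((t (fun=> e))^-1 * b (fun=> e)); apply: altform_inj => w.
rewrite (const1 w); set u := w ord0.
have := congr1 (fun f : altform V 2 => f (fcons e (fun=> u))) tb0.
have -> : (0 : altform V 2) (fcons e (fun=> u)) = 0 by [].
rewrite wedge11E /fcons unlift_none.
have -> : ord_max = lift ord0 ord0 :> 'I_2 by exact/val_inj.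
rewrite liftK => /eqP; rewrite subr_eq0 => /eqP tbE.
apply: (mulfI te); rewrite tbE.
have -> : ((t (fun=> e))^-1 * b (fun=> e) *: t) (fun=> u) =
  (t (fun=> e))^-1 * (b (fun=> e) * t (fun=> u)) by rewrite mulrA.
by rewrite mulVKf // mulrC.
Qed.

End AlternatingForms.

(** * Codimension of common kernels and the extended 3-form *)

Section Codimension.
Context (R : realType) (V : vectType R).

(** Rank-nullity: [m] linear equations cut out a subspace of codimension at
    most [m]. The hypothesis on [vspace_of] says that [A] is a subspace, without
    which [codim A] is a default value. *)
Lemma codim_le_linear m (A : set V) (f : V -> 'rV[R]_m) :
  linear f -> [set` vspace_of A] = A -> (forall u, f u = 0 -> A u) ->
  (codim A <= m)%N.
Proof.
move=> flin AE fA.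
pose F : {linear V -> 'rV[R]_m} :=
  HB.pack f (GRing.isLinear.Build R V 'rV[R]_m _ f flin).
have kerA : (lker (linfun F) <= vspace_of A)%VS.
  apply/subvP => u; rewrite memv_ker lfunE => /eqP /fA.
  by rewrite -[X in X u -> _]AE.
have imm : (\dim (linfun F @: fullv)%VS <= m)%N.
  apply: leq_trans (dimvS (subvf _)) _.
  by rewrite dimvf dim_matrix [leqLHS]mul1r.
rewrite /codim leq_subLR -(limg_ker_dim (linfun F)) capfv.
by apply: leq_add => //; exact: dimvS.
Qed.

Lemma codim_Ker_le2 (t b : altform V 1) (A : set V) :
  [set` vspace_of A] = A -> Ker t `&` Ker b `<=` A -> (codim A <= 2)%N.
Proof.
move=> AE tbA.
pose f u : 'rV[R]_2 :=
  \row_k (if k == ord0 then t (fun=> u) else b (fun=> u)).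
apply: (codim_le_linear (f := f)) => // [a u v|u fu0].
  by apply/rowP => k; rewrite !mxE; case: ifP => _; exact: altform1_linear.
apply: tbA; split; apply/Ker1E.
  by have /rowP/(_ ord0) := fu0; rewrite !mxE.
by have /rowP/(_ ord_max) := fu0; rewrite !mxE.
Qed.

Lemma Ker_wedge12 (t : altform V 1) (o : altform V 2) :
  t <> 0 -> (3 <= codim (Ker t `&` Ker o))%N ->
  Ker (wedge t o) = extended_char t o.
Proof.
move=> t0 codim3.
apply/seteqP; split=> v; last first.
  move=> [/Ker1E tv /(wedge11_eq0P _ t0) tio].
  by rewrite /Ker /= iprod_wedge1 tv tio scale0r subr0.
rewrite {1}/Ker /= iprod_wedge1 => /subr0_eq ovE.
have [tv|tv] := eqVneq (t (fun=> v)) 0.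
  split; first exact/Ker1E.
  by apply/(wedge11_eq0P _ t0); rewrite -ovE tv scale0r.
have : (codim (Ker t `&` Ker o) <= 2)%N.
  apply: (@codim_Ker_le2 t (iprod v o)); first exact: vspace_of_KerI.
  (* Contracting t(v) o = t /\ i_v o with u gives t(u) i_v o - o(v, u) t,
     and both coefficients vanish. *)
  move=> u [tu bu]; split=> //; apply: (scalerI tv).
  have -> : (t (fun=> v) : R) *: iprod u o = iprod u ((t (fun=> v) : R) *: o).
    exact: altform_inj.
  by rewrite ovE iprod_wedge1 bu wedge1_0 (Ker1E t u).1 // scale0r scaler0 subr0.
by rewrite leqNgt codim3.
Qed.

End Codimension.

Theorem proposition3p13 (R : realType) (n : nat) (M : manifold R n)
    (tau : dform M 1) (omega : dform M 2)
    (tau_neq0 : forall x : M, tau x <> 0)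
    (tau_omega_doublet : doublet tau omega)
    (class_ge3 : forall x : M, (3 <= form_class tau omega x)%N) :
  forall x : M,
    Ker (dwedge tau omega x) = extended_char (tau x) (omega x).
Proof. by move=> x; apply: Ker_wedge12; [exact: tau_neq0|exact: class_ge3]. Qed.
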